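(* Let $\{\mu_i(x)\}_{i=0}^n$ be a blending basis and let $\bm A=[\mu_i(x_j)]_{j=0,i=0}^{m,n}\in\mathbb{R}^{(m+1)\times(n+1)}$ ($m\ge n$) be the corresponding collocation matrix on the real increasing sequence $\{x_j\}_{j=0}^m$. Put $\bar{\bm A}=\bm A^T\bm A$ and let $v$ and $u$ be the largest and the smallest eigenvalues of $\bar{\bm A}$, respectively. For a fixed number of iterations $k\ge1$, suppose the step sizes $\{\omega_\ell\}_{\ell=0}^{k-1}$ of the ALSPIA method are $$\omega_\ell=2\left((v+u)+(v-u)\cos\left(\frac{2\ell+1}{2k}\pi\right)\right)^{-1},\qquad \ell=0,1,\dots,k-1.$$ Then, when $\bm A$ is of full rank, the limit, as $k\to\infty$, of the sequence of curves $\{\mathcal{C}^{(k)}(x)\}_{k=0}^\infty$ generated by the ALSPIA method is the least-squares curve of the initial data $\{\bm q_j\}_{j=0}^m$. In such a case, for every $k\ge1$, $$\rho\left(\widehat P_k(\bar{\bm A})\right)\le 2\left(\frac{\sqrt v-\sqrt u}{\sqrt v+\sqrt u}\right)^k,\qquad\text{where}\quad \widehat P_k(\bar{\bm A})=\prod_{\ell=0}^{k-1}\left(\bm I_{n+1}-\omega_\ell\bar{\bm A}\right).$$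
   Context: A blending basis $\{\mu_i\}_{i=0}^n$ is a family of nonnegative real functions on $[x_0,x_m]$ with $\sum_{i=0}^n\mu_i(x)=1$ for all $x$. The data are points $\bm q_0,\dots,\bm q_m$ in $\mathbb{R}^2$ or $\mathbb{R}^3$ with $m\ge n$, where $\bm q_j$ is associated with the parameter $x_j$ and $x_0<x_1<\dots<x_m$. Write $\bm q=[\bm q_0\ \cdots\ \bm q_m]^T$ (one point per row). ALSPIA method (curve fitting): start from arbitrary initial control points $\bm p^{(0)}=[\bm p^{(0)}_0\ \cdots\ \bm p^{(0)}_n]^T$ (one point per row, in the same space as the data) and, given step sizes $\omega_0,\omega_1,\dots$, iterate $$\bm p^{(\ell+1)}=\bm p^{(\ell)}+\omega_\ell\,\bm A^T\left(\bm q-\bm A\bm p^{(\ell)}\right),\qquad \ell=0,1,\dots.$$ The step sizes $\omega_\ell$ depend on the prescribed total number of iterations $k$. For each $k\ge1$, $\bm p^{(k)}$ denotes the control points obtained after $k$ iterations from $\bm p^{(0)}$ with the $k$ step sizes prescribed for that $k$, and $\mathcal{C}^{(k)}(x)=\sum_{i=0}^n\mu_i(x)\bm p^{(k)}_i$, $x\in[x_0,x_m]$; $\mathcal{C}^{(0)}$ is the initial curve, with control points $\bm p^{(0)}$. Limits of curves are taken pointwise in $x\in[x_0,x_m]$. The least-squares curve of the data is the curve $\sum_{i=0}^n\mu_i(x)\bm p^*_i$ whose control points $\bm p^*=[\bm p^*_0\ \cdots\ \bm p^*_n]^T$ form the least-squares solution of $\bm A\bm p=\bm q$, i.e. $\bm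 A^T\bm A\bm p^*=\bm A^T\bm q$ (unique when $\bm A$ has full rank $n+1$). $\rho(\cdot)$ denotes the spectral radius and $\bm I_{n+1}$ the identity matrix of size $n+1$. *)

(* Defs.v *)
From mathcomp Require Import all_boot all_order all_algebra.
From mathcomp Require Import all_classical all_reals all_analysis.
From mathcomp Require Import complex.

Set Implicit Arguments.
Unset Strict Implicit.
Unset Printing Implicit Defensive.

Import Order.TTheory GRing.Theory Num.Theory.
Import numFieldNormedType.Exports.

Local Open Scope classical_set_scope.
Local Open Scope ring_scope.

Section Alspia.
Variable R : realType.

Definition blending_basis (a b : R) (n : nat) (mu : 'I_n.+1 -> R -> R) : Prop :=
  (forall i x, a <= x <= b -> 0 <= mu i x) /\
  (forall x, a <= x <= b -> \sum_i mu i x = 1).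

Definition collocation (m n : nat) (mu : 'I_n.+1 -> R -> R)
    (x : 'I_m.+1 -> R) : 'M[R]_(m.+1, n.+1) :=
  \matrix_(j, i) mu i (x j).

(* The points of a d-dimensional space are row vectors; [p] has one control
   point per row. *)
Definition curve (n d : nat) (mu : 'I_n.+1 -> R -> R) (p : 'M[R]_(n.+1, d))
    (x : R) : 'rV[R]_d :=
  \sum_i mu i x *: row i p.

Fixpoint alspia (m n d : nat) (A : 'M[R]_(m, n)) (q : 'M[R]_(m, d))
    (w : nat -> R) (p0 : 'M[R]_(n, d)) (l : nat) : 'M[R]_(n, d) :=
  if l is l'.+1 then
    let p := alspia A q w p0 l' in p + w l' *: (A^T *m (q - A *m p))
  else p0.

Definition least_squares_solution (m n d : nat) (A : 'M[R]_(m, n))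
    (q : 'M[R]_(m, d)) (p : 'M[R]_(n, d)) : Prop :=
  A^T *m A *m p = A^T *m q.

(* [eigenvalue] ranges over the field of the entries of [M], here the reals. *)
Definition largest_eigenvalue (n : nat) (M : 'M[R]_n) (v : R) : Prop :=
  eigenvalue M v /\ (forall a, eigenvalue M a -> a <= v).

Definition smallest_eigenvalue (n : nat) (M : 'M[R]_n) (u : R) : Prop :=
  eigenvalue M u /\ (forall a, eigenvalue M a -> u <= a).

(* All complex eigenvalues are taken into account. For n > 0 their set is
   finite and nonempty, so that [sup] is a maximum. *)
Definition spectral_radius (n : nat) (M : 'M[R]_n) : R :=
  sup [set ComplexField.Normc.normc z |
       z in [set z : R[i] | eigenvalue (map_mx (real_complex R) M) z]].

End Alspia.

(* Main.v *)
Require Import Defs.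
From mathcomp Require Import all_boot all_order all_algebra.
From mathcomp Require Import all_classical all_reals all_analysis.
From mathcomp Require Import complex ring lra zify.

Import Order.TTheory GRing.Theory Num.Theory.
Import numFieldNormedType.Exports.

Local Open Scope classical_set_scope.
Local Open Scope ring_scope.

(** The proof is the classical analysis of Chebyshev semi-iteration.

    Write M for the Gram matrix A^T A and p* for the least-squares solution.
    Since A^T q = M p*, one step multiplies the error p - p* by 1 - w_l M, so
    after k steps the error is f(M) applied to the initial error, where
    f = \prod_(l < k) (1 - w_l X) ([alspia_error]).  The matrix in the
    spectral bound is the same f(M).  As M is symmetric, both claims are
    governed by the size of f on the real spectrum of M, which lies in
    [u, v]: by diagonalization, a bound for |f| there bounds the spectral
    radius of f(M) ([spectral_radius_horner_mx]) and, up to a constant that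
    does not depend on f, every entry of f(M) ([horner_mx_entry_bound]).

    The step sizes are the inverses of the zeros of the Chebyshev polynomial
    T_k transported from [-1, 1] to [u, v].  As f(0) = 1, this forces
    f(lam) = T_k(s(lam)) / T_k(s(0)) for the affine map s that sends [u, v]
    onto [-1, 1].  On the spectrum the numerator is at most 1 in absolute
    value.  With c = (sqrt v - sqrt u) / (sqrt v + sqrt u) one has
    s(0) = - (c + 1/c) / 2, and T_k((y + 1/y) / 2) = (y^k + y^-k) / 2 shows
    that the denominator is at least c^-k / 2 in absolute value; hence
    |f| <= 2 c^k on [u, v] ([chebyshev_step_bound]).

    Full rank of A makes M positive definite, so u > 0 and c < 1, and the
    control points converge geometrically.  A point of the curve is a fixed
    linear combination of the control points, hence converges too. *)

(** * Chebyshev polynomials *)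

Section ChebyshevPolynomials.
Variable R : realType.
Implicit Types (k l : nat) (t y : R).

Fixpoint chebyshev k : {poly R} :=
  if k is k1.+1 then
    if k1 is k2.+1 then 'X * chebyshev k1 *+ 2 - chebyshev k2 else 'X
  else 1.

Lemma chebyshevSS k :
  chebyshev k.+2 = 'X * chebyshev k.+1 *+ 2 - chebyshev k.
Proof. by []. Qed.

(** The recurrence reaches two steps back, so inductions on the degree carry
    two consecutive cases. *)
Lemma chebyshev_rec_ind (P : nat -> Prop) :
  P 0 -> P 1 -> (forall k, P k -> P k.+1 -> P k.+2) -> forall k, P k.
Proof.
move=> P0 P1 PSS k; suff [] : P k /\ P k.+1 by [].
by elim: k => [|k [Pk PSk]]; split=> //; exact: PSS.
Qed.

(** The recurrence is the identity
    cos ((j + 1) t) + cos ((j - 1) t) = 2 cos t cos (j t) with j = k + 1. *)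
Lemma chebyshev_cos k t : (chebyshev k).[cos t] = cos (k%:R * t).
Proof.
elim/chebyshev_rec_ind: k => [||k IHk IHSk].
- by rewrite /= hornerE mul0r cos0.
- by rewrite /= hornerE mul1r.
- rewrite chebyshevSS !hornerE IHk IHSk.
  have -> : k.+2%:R * t = k.+1%:R * t + t by rewrite -[k.+2]addn1 natrD; ring.
  have -> : k%:R * t = k.+1%:R * t - t by rewrite -[k.+1]addn1 natrD; ring.
  by rewrite cosB cosD; ring.
Qed.

(** The algebraic form of [chebyshev_cos]: y plays the role of e^(it).  It gives
    the values of the polynomial outside [-1, 1], where it grows
    geometrically with k. *)
Lemma chebyshev_joukowsky k y : y != 0 ->
  (chebyshev k).[(y + y^-1) / 2] = (y ^+ k + y ^- k) / 2.
Proof.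
move=> y0; elim/chebyshev_rec_ind: k => [||k IHk IHSk].
- by rewrite /= hornerE !expr0 invr1; field.
- by rewrite /= hornerE !expr1.
- rewrite chebyshevSS !hornerE IHk IHSk -!exprVn !exprS.
  have yV : y * y^-1 = 1 by rewrite divff.
  set z := y^-1 in yV *; set a := y ^+ k; set b := z ^+ k.
  have -> : (y * (y * a) + z * (z * b)) / 2 =
    (y + z) / 2 * ((y * a + z * b) / 2) *+ 2 - (y * z) * (a + b) / 2 by field.
  by rewrite yV mul1r.
Qed.

Lemma size_chebyshev k : size (chebyshev k) = k.+1.
Proof.
elim/chebyshev_rec_ind: k => [||k IHk IHSk]; rewrite ?size_poly1 ?size_polyX//.
have T0 : chebyshev k.+1 != 0 by rewrite -size_poly_eq0 IHSk.
have sX : size ('X * chebyshev k.+1 *+ 2) = k.+3.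
  by rewrite -scaler_nat size_scale ?pnatr_eq0// mulrC size_mulX// IHSk.
by rewrite chebyshevSS size_polyDl ?size_polyN sX ?IHk.
Qed.

(** The l-th zero of the k-th Chebyshev polynomial, counted from 1 down to
    -1. *)
Definition chebyshev_node k l : R := cos ((2 * l + 1)%:R / (2 * k)%:R * pi).

(** [cos] is injective on [0, pi], so this makes the k nodes distinct. *)
Lemma chebyshev_node_angle k l : (l < k)%N ->
  ((2 * l + 1)%:R / (2 * k)%:R * pi : R) \in `[0, pi]%R.
Proof.
move=> lk; have k0 : 0 < (2 * k)%:R :> R by rewrite ltr0n; case: k lk.
rewrite in_itv /= mulr_ge0 ?pi_ge0 ?divr_ge0//=.
by rewrite ler_piMl ?pi_ge0// ler_pdivrMr// mul1r ler_nat; lia.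
Qed.

Lemma root_chebyshev k l : (l < k)%N -> root (chebyshev k) (chebyshev_node k l).
Proof.
move=> lk; rewrite rootE /chebyshev_node chebyshev_cos.
have k0 : k%:R != 0 :> R by rewrite pnatr_eq0; case: k lk.
have -> : k%:R * ((2 * l + 1)%:R / (2 * k)%:R * pi) = pi / 2 + l%:R * pi :> R.
  by rewrite natrD !natrM; field.
elim: l {lk} => [|l IHl]; first by rewrite mul0r addr0 cos_pihalf.
have -> : pi / 2 + l.+1%:R * pi = pi / 2 + l%:R * pi + pi :> R.
  by rewrite -[l.+1]addn1 natrD; ring.
by rewrite cosDpi oppr_eq0.
Qed.

Lemma chebyshev_node_inj k :
  {in [pred l | (l < k)%N] &, injective (chebyshev_node k)}.
Proof.
move=> l l' /[!inE] lk l'k /cos_inj.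
move=> /(_ (chebyshev_node_angle _ _ lk) (chebyshev_node_angle _ _ l'k)).
move=> /(mulIf (lt0r_neq0 (pi_gt0 R))).
have k0 : (2 * k)%:R^-1 != 0 :> R by rewrite invr_eq0 pnatr_eq0; case: k lk l'k.
by move=> /(mulIf k0) /eqP; rewrite eqr_nat => /eqP; lia.
Qed.

(** The k distinct nodes are zeros of a polynomial of degree k, so they are all
    of its zeros. *)
Lemma chebyshev_factor k : chebyshev k =
  lead_coef (chebyshev k) *: \prod_(l < k) ('X - (chebyshev_node k l)%:P).
Proof.
rewrite {1}(@all_roots_prod_XsubC _ (chebyshev k)
  (mkseq (chebyshev_node k) k)).
- rewrite -(big_mkord xpredT (fun l => 'X - (chebyshev_node k l)%:P)).
  by rewrite /index_iota subn0 big_map.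
- by rewrite size_chebyshev size_mkseq.
- apply/allP=> _ /mapP[l + ->]; rewrite mem_iota => lk.
  exact: root_chebyshev.
- rewrite uniq_rootsE map_inj_in_uniq ?iota_uniq// => l l'.
  by rewrite !mem_iota; exact: chebyshev_node_inj.
Qed.

Lemma chebyshev_le1 k t : -1 <= t <= 1 -> `|(chebyshev k).[t]| <= 1.
Proof.
move=> t1; rewrite -(@acosK _ t) ?in_itv//= chebyshev_cos.
by rewrite ler_norml cos_geN1 cos_le1.
Qed.

(** Dividing the values at two points cancels the leading coefficient in
    [chebyshev_factor]. *)
Lemma chebyshev_prod_ratio k (s s0 : R) : (chebyshev k).[s0] != 0 ->
  \prod_(l < k) ((s - chebyshev_node k l) / (s0 - chebyshev_node k l)) =
  (chebyshev k).[s] / (chebyshev k).[s0].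
Proof.
move=> T0; rewrite big_split /= prodfV.
have E t : \prod_(l < k) (t - chebyshev_node k l) =
    (chebyshev k).[t] / lead_coef (chebyshev k).
  rewrite {1}chebyshev_factor hornerZ horner_prod mulrAC divff ?mul1r.
    by apply: eq_bigr => l _; rewrite hornerXsubC.
  by rewrite lead_coef_eq0 -size_poly_eq0 size_chebyshev.
have L0 : lead_coef (chebyshev k) != 0.
  by rewrite lead_coef_eq0 -size_poly_eq0 size_chebyshev.
by rewrite !E; field; rewrite T0 L0.
Qed.

End ChebyshevPolynomials.

(** * The step sizes and the scalar residual *)

Section StepSizes.
Variables (R : realType) (u v : R).
Hypotheses (u0 : 0 < u) (uv : u <= v).

Definition convergence_factor : R :=
  (Num.sqrt v - Num.sqrt u) / (Num.sqrt v + Num.sqrt u).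

Let c := convergence_factor.

Lemma convergence_factor_ge0 : 0 <= c.
Proof. by rewrite divr_ge0 ?subr_ge0 ?addr_ge0 ?sqrtr_ge0 ?ler_wsqrtr. Qed.

Lemma convergence_factor_lt1 : c < 1.
Proof.
have su : 0 < Num.sqrt u by rewrite sqrtr_gt0.
have sv := sqrtr_ge0 v.
rewrite /c /convergence_factor ltr_pdivrMr; lra.
Qed.

(** Identifies -(v + u) / (v - u), the image of 0 under the affine map from
    [u, v] onto [-1, 1], as the Joukowsky value at -c. *)
Lemma convergence_factor_joukowsky : u < v ->
  (c + c^-1) / 2 = (v + u) / (v - u).
Proof.
move=> ltuv; rewrite /c /convergence_factor.
have su : 0 < Num.sqrt u by rewrite sqrtr_gt0.
have suv : Num.sqrt u < Num.sqrt v by rewrite ltr_sqrt// (lt_trans u0).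
have Eu : u = Num.sqrt u ^+ 2 by rewrite sqr_sqrtr// ltW.
have Ev : v = Num.sqrt v ^+ 2 by rewrite sqr_sqrtr// ltW// (lt_trans u0).
have -> : (v + u) / (v - u) = (Num.sqrt v ^+ 2 + Num.sqrt u ^+ 2) /
   (Num.sqrt v ^+ 2 - Num.sqrt u ^+ 2) by rewrite -Eu -Ev.
set a := Num.sqrt u in su suv *; set b := Num.sqrt v in suv *.
have ba : b - a != 0 by rewrite subr_eq0 gt_eqF.
have abp : b + a != 0 by rewrite gt_eqF// addr_gt0// (lt_trans su).
by rewrite subr_sqr; field; rewrite ba abp.
Qed.

(** The factor 1 - w lam vanishes where the affine image of lam is the node and
    equals 1 at lam = 0; both sides are the affine function of lam with these
    two properties. *)
Lemma chebyshev_step_factor k l (w lam : R) : u < v ->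
  w = 2 * ((v + u) + (v - u) * chebyshev_node R k l)^-1 ->
  1 - w * lam = ((2 * lam - (v + u)) / (v - u) - chebyshev_node R k l) /
                (- (v + u) / (v - u) - chebyshev_node R k l).
Proof.
move=> ltuv ->; set x := chebyshev_node R k l.
have x_geN1 : - 1 <= x by exact: cos_geN1.
have vu : v - u != 0 by rewrite subr_eq0 gt_eqF.
have r0 : (v + u) + (v - u) * x != 0.
  have : 0 <= (v - u) * (x + 1).
    by rewrite mulr_ge0 ?subr_ge0 ?(ltW ltuv) -?lerBlDr ?sub0r.
  move=> vux; rewrite gt_eqF// (_ : _ + _ = (v - u) * (x + 1) + u *+ 2).
    by rewrite ltr_wpDl ?pmulrn_lgt0.
  by ring.
field; rewrite r0 vu /= andbT -oppr_eq0.
by rewrite (_ : - (_ + _ * _) = (v + u) + (v - u) * x) //; ring.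
Qed.

(** When u < v the product is T_k(s) / T_k(s0) with s in [-1, 1], and the
    numerator and the denominator are estimated separately.  When u = v the
    affine map degenerates, but then lam = u and every step size is 1 / u, so
    the product vanishes unless it is empty. *)
Lemma chebyshev_step_bound k (w : nat -> R) (lam : R) :
  (forall l, (l < k)%N ->
     w l = 2 * ((v + u) + (v - u) * chebyshev_node R k l)^-1) ->
  u <= lam <= v -> `|\prod_(l < k) (1 - w l * lam)| <= 2 * c ^+ k.
Proof.
move=> wE /andP[ul lv]; have [vu | ltuv] := leP v u.
  have vE : v = u by apply/eqP; rewrite eq_le vu uv.
  have lE : lam = u by apply/eqP; rewrite eq_le ul -vE lv.
  have c0 : c = 0 by rewrite /c /convergence_factor vE subrr mul0r.
  case: k wE => [|k] wE; first by rewrite big_ord0 expr0 normr1 mulr1 ler1n.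
  rewrite big_ord_recl /= wE// lE vE subrr mul0r addr0.
  rewrite (_ : 1 - _ = 0) ?mul0r ?normr0 ?c0 ?expr0n ?mulr0//.
  by field; rewrite gt_eqF// addr_gt0.
have c_gt0 : 0 < c.
  have v0 := lt_trans u0 ltuv.
  by rewrite divr_gt0 ?subr_gt0 ?ltr_sqrt ?addr_gt0 ?sqrtr_gt0.
have ck0 : 0 < c ^+ k by rewrite exprn_gt0.
have ckV0 : 0 < c ^- k by rewrite invr_gt0 exprn_gt0.
set s0 := - (v + u) / (v - u).
have s0E : s0 = (- c + (- c)^-1) / 2.
  by rewrite invrN -opprD mulNr convergence_factor_joukowsky// /s0 mulNr.
have T0 : `|(chebyshev R k).[s0]| = (c ^+ k + c ^- k) / 2.
  rewrite s0E chebyshev_joukowsky ?oppr_eq0 ?gt_eqF//.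
  rewrite exprNn invfM invr_sign -mulrDr -mulrA normrMsign ger0_norm//.
  by rewrite divr_ge0// addr_ge0 ?(ltW ck0) ?(ltW ckV0).
have T0_gt0 : 0 < `|(chebyshev R k).[s0]|.
  by rewrite T0; exact: (divr_gt0 (addr_gt0 ck0 ckV0) (ltr0Sn _ 1)).
under eq_bigr => l _ do
  rewrite (chebyshev_step_factor _ _ _ _ ltuv (wE l (ltn_ord l))).
rewrite chebyshev_prod_ratio -?normr_gt0// normrM normfV.
have Ts : `|(chebyshev R k).[(2 * lam - (v + u)) / (v - u)]| <= 1.
  have vu0 : 0 < v - u by rewrite subr_gt0.
  by apply: chebyshev_le1; rewrite ler_pdivlMr// ler_pdivrMr//;
     apply/andP; split; lra.
(* 2 c^k (c^k + c^-k) / 2 = c^(2k) + 1 >= 1. *)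
rewrite ler_pdivrMr// (le_trans Ts)// T0.
rewrite (_ : _ * _ * _ = c ^+ k ^+ 2 + 1).
  by rewrite lerDr sqr_ge0.
by field; rewrite gt_eqF.
Qed.

End StepSizes.

(** * Polynomials in a symmetric matrix *)

Section SymmetricMatrices.
Variables (R : realType) (n : nat).
Implicit Types (M : 'M[R]_n.+1) (f : {poly R}).

Local Notation toC := (real_complex R).
Local Notation normc := ComplexField.Normc.normc.

Lemma normc_ge0 (z : R[i]) : 0 <= normc z.
Proof. by case: z => a b; exact: sqrtr_ge0. Qed.

Lemma normc_real (a : R) : normc (toC a) = `|a|.
Proof. by rewrite /= expr0n /= addr0 sqrtr_sqr. Qed.

(** A real symmetric matrix is hermitian over the complex numbers, so it is
    diagonalizable there with real diagonal entries, and the rows of P are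
    eigenvectors.  The diagonal is returned as real eigenvalues of M itself:
    bounds on the real spectrum then control everything, including the complex
    eigenvalues in [spectral_radius]. *)
Lemma symmetric_diagonalizable M : M^T = M ->
  exists (P : 'M[R[i]]_n.+1) (D : 'rV[R]_n.+1), [/\ P \in unitmx,
    forall j, eigenvalue M (D 0 j) &
    map_mx toC M = invmx P *m diag_mx (map_mx toC D) *m P].
Proof.
move=> Msym; set MC := map_mx toC M.
have MCh : MC \is hermsymmx.
  apply: realsym_hermsym.
    apply/is_hermitianmxP; rewrite expr0 scale1r map_mx_id//.
    by rewrite /MC map_trmx Msym.
  by apply/mxOverP => i j; rewrite mxE complex_real.
have /orthomx_spectralP MCE := hermitian_normalmx MCh.
pose P := spectralmx MC.
pose D := map_mx (@complex.Re R) (spectral_diag MC).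
have DE : map_mx toC D = spectral_diag MC.
  apply/rowP => j; rewrite !mxE RRe_real//.
  by have /mxOverP := hermitian_spectral_diag_real MCh; apply.
have Pu : P \in unitmx := spectral_unit _.
exists P, D; rewrite DE; split=> // j.
rewrite -(eigenvalue_map toC); apply/eigenvalueP; exists (row j P); last first.
  apply: contraTneq Pu => Pj0; rewrite -row_free_unit -kermx_eq0.
  apply/negP => /eqP K0.
  have : (delta_mx 0 j : 'rV_n.+1) *m P = 0 by rewrite -rowE.
  move=> /eqP; rewrite -sub_kermx K0 submx0 => /eqP /matrixP /(_ 0 j) /eqP.
  by rewrite !mxE !eqxx oner_eq0.
rewrite -/MC {1}MCE -row_mul !mulmxA mulmxV// mul1mx.
by rewrite row_mul row_diag_mx -scalemxAl -rowE -DE !mxE.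
Qed.

Lemma horner_mx_diagonalized (P : 'M[R[i]]_n.+1) (D : 'rV[R]_n.+1) M f :
  P \in unitmx -> map_mx toC M = invmx P *m diag_mx (map_mx toC D) *m P ->
  map_mx toC (horner_mx M f) =
  invmx P *m diag_mx (map_mx (toC \o horner f) D) *m P.
Proof.
move=> Pu ME; rewrite map_horner_mx ME -{2}[P]invmxK.
have Piu : invmx P \in unitmx by rewrite unitmx_inv.
rewrite (horner_mx_uconj _ _ Piu) invmxK.
congr (_ *m _ *m _); rewrite horner_mx_diag; congr diag_mx.
by apply/rowP => j; rewrite !mxE /= horner_map.
Qed.

(** In the diagonalizing basis an eigenvector of f(M) has a nonzero coordinate,
    and reading the eigenvalue equation there shows that the complex eigenvalue
    is f(a) for a real eigenvalue a of M. *)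
Lemma spectral_radius_horner_mx M f b : M^T = M -> 0 <= b ->
  (forall a, eigenvalue M a -> `|f.[a]| <= b) ->
  spectral_radius (horner_mx M f) <= b.
Proof.
move=> Msym b0 fb; have [P [D [Pu DM ME]]] := symmetric_diagonalizable _ Msym.
rewrite /spectral_radius; set S := (X in sup X).
have [->|S0] := eqVneq S set0; first by rewrite sup0.
apply: ge_sup; first exact/set0P.
move=> _ [z /= /eigenvalueP[w wz w0] <-].
rewrite (horner_mx_diagonalized _ _ _ _ Pu ME) in wz.
pose y := w *m invmx P.
have yz : y *m diag_mx (map_mx (toC \o horner f) D) = z *: y.
  by rewrite scalemxAl -wz !mulmxA mulmxK.
have /rV0Pn[j yj] : y != 0.
  by apply: contraNneq w0 => y0; rewrite -(mulmxKV Pu w) -/y y0 mul0mx.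
clearbody y; have /rowP/(_ j) := yz.
rewrite mul_mx_diag !mxE mulrC => /(mulIf yj) <-.
by rewrite -[(toC \o _) _]/(toC _) normc_real fb.
Qed.

(** The constants come from the diagonalizing basis alone.  Being independent of
    f, they serve all the residual polynomials, whose degree grows, at once. *)
Lemma horner_mx_entry_bound M : M^T = M ->
  exists K : 'I_n.+1 -> 'I_n.+1 -> R, forall f (b : R),
    (forall a, eigenvalue M a -> `|f.[a]| <= b) ->
    forall i j, `|horner_mx M f i j| <= K i j * b.
Proof.
move=> Msym; have [P [D [Pu DM ME]]] := symmetric_diagonalizable _ Msym.
exists (fun i j => \sum_s normc (invmx P i s) * normc (P s j)) => f b fb i j.
have /matrixP/(_ i j) := horner_mx_diagonalized _ _ _ f Pu ME.
rewrite mul_mx_diag !mxE => E.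
rewrite -normc_real E.
apply: le_trans
  (_ : _ <= \sum_s normc (invmx P i s * toC f.[D 0 s] * P s j)) _.
  elim/big_ind2: _ => [|x1 x2 y1 y2|].
  - by rewrite ComplexField.Normc.normc0.
  - move=> h1 h2; apply: le_trans (le_normcD _ _) _.
    exact: lerD.
  by move=> s _; rewrite !mxE.
rewrite mulr_suml; apply: ler_sum => s _.
rewrite !ComplexField.Normc.normcM mulrAC ler_wpM2l//.
  by rewrite mulr_ge0 ?normc_ge0.
by rewrite normc_real fb.
Qed.

End SymmetricMatrices.

(** * Normal equations and the error of the iteration *)

Section LeastSquares.
Variables (R : realType) (m n d : nat).
Implicit Types (A : 'M[R]_(m, n.+1)) (w : nat -> R).

Lemma gram_symmetric A : (A^T *m A)^T = A^T *m A.
Proof. by rewrite trmx_mul trmxK. Qed.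

(** For a row eigenvector z, |z A^T|^2 = a |z|^2, and z A^T is nonzero because
    A^T has independent rows. *)
Lemma gram_eigenvalue_gt0 A a :
  \rank A = n.+1 -> eigenvalue (A^T *m A) a -> 0 < a.
Proof.
move=> rkA /eigenvalueP[z zE z0].
have sq_gt0 p (y : 'rV[R]_p) : y != 0 -> 0 < (y *m y^T) 0 0.
  move=> /rV0Pn[j yj]; rewrite mxE (bigD1 j)//= ltr_wpDr//.
    by apply: sumr_ge0 => i _; rewrite mxE -expr2 sqr_ge0.
  by rewrite mxE -expr2 exprn_even_gt0.
have zA : z *m A^T != 0.
  apply: contraNneq z0 => zA0; apply/eqP/(@row_free_inj _ _ _ _ A^T).
    by rewrite /row_free mxrank_tr rkA.
  by rewrite /= zA0 mul0mx.
have := sq_gt0 _ _ zA; rewrite trmx_mul trmxK mulmxA -(mulmxA z) zE.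
by rewrite -scalemxAl mxE pmulr_lgt0// sq_gt0.
Qed.

Lemma gram_unit A : \rank A = n.+1 -> A^T *m A \in unitmx.
Proof.
move=> rkA; rewrite -row_free_unit -kermx_eq0; apply/negPn/negP => kerA.
have : eigenvalue (A^T *m A) 0 by rewrite /eigenvalue /eigenspace raddf0 subr0.
by move=> /(gram_eigenvalue_gt0 _ _ rkA); rewrite ltxx.
Qed.

Lemma unique_least_squares A (q : 'M[R]_(m, d)) : \rank A = n.+1 ->
  unique (least_squares_solution A q) (invmx (A^T *m A) *m (A^T *m q)).
Proof.
move=> /gram_unit Mu; split; rewrite /least_squares_solution ?mulKVmx// => p <-.
by rewrite mulKmx.
Qed.

(** By the normal equations A^T (q - A p) = - A^T A (p - ps), so each step
    multiplies the error on the left by the next factor.  The new factor enters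
    on the opposite side of the product, and the factors commute. *)
Lemma alspia_error A (q : 'M[R]_(m, d)) w p0 ps k :
  least_squares_solution A q ps ->
  alspia A q w p0 k - ps =
  (\prod_(l < k) (1%:M - w l *: (A^T *m A))) *m (p0 - ps).
Proof.
rewrite /least_squares_solution => psE.
elim: k => [|k IHk]; first by rewrite big_ord0 mul1mx.
have wkC : GRing.comm (1%:M - w k *: (A^T *m A))
    (\prod_(l < k) (1%:M - w l *: (A^T *m A))).
  apply: commr_prod => l _; apply: commrB; first exact: commr1.
  apply: commr_sym; apply: commrB; first exact: commr1.
  by rewrite /GRing.comm -!scalerAl -!scalerAr scalerA mulrC -scalerA.
rewrite big_ord_recr /= -wkC.
rewrite -mulmxA -IHk /= mulmxBr -psE mulmxA -mulmxBr mulmxBl mul1mx.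
set p := alspia _ _ _ _ _.
by rewrite -scalemxAl -(opprB p ps) mulmxN scalerN addrAC.
Qed.

Definition step_poly w k : {poly R} := \prod_(l < k) (1 - w l *: 'X).

Lemma horner_step_poly w k a :
  (step_poly w k).[a] = \prod_(l < k) (1 - w l * a).
Proof. by rewrite horner_prod; apply: eq_bigr => l _; rewrite !hornerE. Qed.

Lemma horner_mx_step_poly (M : 'M[R]_n.+1) w k :
  horner_mx M (step_poly w k) = \prod_(l < k) (1%:M - w l *: M).
Proof.
rewrite rmorph_prod; apply: eq_bigr => l _.
rewrite rmorphB rmorph1 -mul_polyC rmorphM /= horner_mx_C horner_mx_X.
by congr (_ - _); exact: mul_scalar_mx.
Qed.

End LeastSquares.


(** * Convergence *)

Lemma cvg_mx_entries (R : realType) (m n : nat) (F : nat -> 'M[R]_(m, n))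
    (L : 'M[R]_(m, n)) :
  (forall i j, F k i j @[k --> \oo] --> L i j) -> F k @[k --> \oo] --> L.
Proof.
move=> FL B [P LP sPB].
have : \forall k \near \oo, forall i, forall j, P i j (F k i j).
  apply: filter_forall => i; apply: filter_forall => j.
  exact: FL (LP i j).
by apply: filterS => k Pk; apply: sPB.
Qed.

Lemma cvg_sum (R : realType) (I : Type) (r : seq I) (F : I -> nat -> R)
    (L : I -> R) :
  (forall i, F i k @[k --> \oo] --> L i) ->
  \sum_(i <- r) F i k @[k --> \oo] --> \sum_(i <- r) L i.
Proof.
move=> FL; elim: r => [|i r IHr].
  by rewrite big_nil; under eq_fun do rewrite big_nil; exact: cvg_cst.
by rewrite big_cons; under eq_fun do rewrite big_cons; exact: cvgD.
Qed.

(** The step sizes may change entirely from one k to the next, so the iterates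
    for different k are not successive terms of one iteration; the error formula
    for each k separately, with constants independent of k, suffices. *)
Lemma alspia_entry_cvg (R : realType) (m n d : nat)
    (A : 'M[R]_(m, n.+1)) (q : 'M[R]_(m, d)) (p0 ps : 'M[R]_(n.+1, d))
    (w : nat -> nat -> R) (b c : R) : `|c| < 1 ->
  (forall k a, eigenvalue (A^T *m A) a ->
     `|\prod_(l < k) (1 - w k l * a)| <= b * c ^+ k) ->
  least_squares_solution A q ps ->
  forall i j, alspia A q (w k) p0 k i j @[k --> \oo] --> ps i j.
Proof.
move=> c1 wb psE i j.
have [K Kb] := horner_mx_entry_bound _ _ _ (gram_symmetric _ _ _ A).
set C := \sum_s K i s * `|(p0 - ps) s j|.
apply/subr_cvg0/norm_cvg0P.
apply: (squeeze_cvgr (f := cst 0) (h := geometric (C * b) c)).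
- apply: nearW => k /=; rewrite normr_ge0 /=.
  have -> : alspia A q (w k) p0 k i j - ps i j =
      (alspia A q (w k) p0 k - ps) i j.
    by rewrite !mxE.
  rewrite (alspia_error _ _ _ _ _ _ _ _ _ _ psE) -horner_mx_step_poly mxE.
  apply: le_trans (ler_norm_sum _ _ _) _; rewrite -mulrA !mulr_suml.
  apply: ler_sum => s _; rewrite normrM mulrAC ler_wpM2r//.
  by apply: Kb => a /wb; rewrite horner_step_poly.
- exact: cvg_cst.
- exact: cvg_geometric.
Qed.

Theorem theorem3p2 (R : realType) (m n d : nat) (hd : d = 2%N \/ d = 3%N)
    (hmn : (n <= m)%N)
    (x : 'I_m.+1 -> R) (hx : forall i j : 'I_m.+1, (i < j)%N -> x i < x j)
    (mu : 'I_n.+1 -> R -> R) (hmu : blending_basis (x ord0) (x ord_max) mu)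
    (q : 'M[R]_(m.+1, d)) (p0 : 'M[R]_(n.+1, d))
    (A : 'M[R]_(m.+1, n.+1)) (hA : A = collocation mu x)
    (v u : R) (hv : largest_eigenvalue (A^T *m A) v)
    (hu : smallest_eigenvalue (A^T *m A) u)
    (* [omega k l] is the l-th step size prescribed for k iterations *)
    (omega : nat -> nat -> R)
    (homega : forall k l : nat, (1 <= k)%N -> (l < k)%N ->
       omega k l = 2 * ((v + u) +
         (v - u) * cos ((2 * l + 1)%:R / (2 * k)%:R * pi))^-1)
    (hrank : \rank A = n.+1) :
  (exists pstar : 'M[R]_(n.+1, d),
     unique (least_squares_solution A q) pstar /\
     (forall t : R, x ord0 <= t <= x ord_max ->
        curve mu (alspia A q (omega k) p0 k) t @[k --> \oo]
          --> curve mu pstar t)) /\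
  (forall k : nat, (1 <= k)%N ->
     spectral_radius (\prod_(l < k) (1%:M - omega k l *: (A^T *m A)))
       <= 2 * ((Num.sqrt v - Num.sqrt u) / (Num.sqrt v + Num.sqrt u)) ^+ k).
Proof.
have [eigu minu] := hu; have [eigv maxv] := hv.
have u0 : 0 < u := gram_eigenvalue_gt0 _ _ _ _ _ hrank eigu.
have uv : u <= v := minu _ eigv.
have bound k a : eigenvalue (A^T *m A) a ->
    `|\prod_(l < k) (1 - omega k l * a)| <= 2 * convergence_factor _ u v ^+ k.
  move=> eiga; apply: chebyshev_step_bound => // [l lk|].
    by apply: homega => //; case: k lk.
  by rewrite minu// maxv.
have c0 := convergence_factor_ge0 _ _ _ uv.
have c1 := convergence_factor_lt1 _ _ v u0.
have [psE psU] := unique_least_squares _ _ _ _ _ q hrank.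
split.
- exists (invmx (A^T *m A) *m (A^T *m q)); split=> // t _.
  have entry_cvg := alspia_entry_cvg _ _ _ _ _ _ p0 _ _ _ _ _ bound psE.
  apply: cvg_mx_entries => i j.
  have curveE (p : 'M[R]_(n.+1, d)) : curve mu p t i j = \sum_s mu s t * p s j.
    by rewrite summxE; apply: eq_bigr => s _; rewrite !mxE.
  rewrite curveE; under eq_fun do rewrite curveE.
  apply: (cvg_sum _ _ _
    (fun s k => mu s t * alspia A q (omega k) p0 k s j)) => s.
  apply: cvgMl_tmp.
  by apply: entry_cvg; rewrite ger0_norm.
- move=> k _; rewrite -horner_mx_step_poly.
  apply: spectral_radius_horner_mx; first exact: gram_symmetric.
    by rewrite mulr_ge0// exprn_ge0.
  by move=> a /bound; rewrite horner_step_poly.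
Qed.
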